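(* Let $n\ge 1$, let $\boldsymbol{a},\boldsymbol{b}\in\mathbb{R}^n$ with $a_i<b_i$ for all $i$, and let $f:[\boldsymbol{a},\boldsymbol{b}]\to\mathbb{R}$ be a jointly monotone increasing function on the rectangle $[\boldsymbol{a},\boldsymbol{b}]=\prod_{i=1}^n[a_i,b_i]$. Then for every $\boldsymbol{\epsilon}\in\{-1,1\}^n$, the joint derivative $D_{\boldsymbol{\epsilon}}f(\boldsymbol{x})$ in the $\boldsymbol{\epsilon}$-th quadrant exists for almost every $\boldsymbol{x}\in[\boldsymbol{a},\boldsymbol{b}]$. Moreover, for any $\boldsymbol{\epsilon}\ne\boldsymbol{\epsilon}'$ in $\{-1,1\}^n$, $$D_{\boldsymbol{\epsilon}}f(\boldsymbol{x})=D_{\boldsymbol{\epsilon}'}f(\boldsymbol{x})\quad\text{for almost every }\boldsymbol{x}\in[\boldsymbol{a},\boldsymbol{b}].$$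
   Context: For $\boldsymbol{c},\boldsymbol{d}\in\mathbb{R}^n$, $\boldsymbol{c}\le\boldsymbol{d}$ means $c_i\le d_i$ for all $i$, and $[\boldsymbol{c},\boldsymbol{d}]=\prod_i[c_i,d_i]$. The joint increment of $f$ over $[\boldsymbol{c},\boldsymbol{d}]$ is $$\Delta_f^n[\boldsymbol{c},\boldsymbol{d}]=\sum_{\epsilon_1,\dots,\epsilon_n\in\{0,1\}}(-1)^{n+\epsilon_1+\dots+\epsilon_n}f\big(c_1+\epsilon_1(d_1-c_1),\dots,c_n+\epsilon_n(d_n-c_n)\big).$$ $f$ is jointly monotone increasing on $[\boldsymbol{a},\boldsymbol{b}]$ if $\Delta_f^n[\boldsymbol{x},\boldsymbol{y}]\ge 0$ for all $\boldsymbol{x}\le\boldsymbol{y}$ in $[\boldsymbol{a},\boldsymbol{b}]$. For $\boldsymbol{\epsilon}=(\epsilon_1,\dots,\epsilon_n)\in\{-1,1\}^n$ and $\boldsymbol{x}$ in a neighborhood of which $f$ is defined, the joint derivative in the $\boldsymbol{\epsilon}$-th quadrant is $$D_{\boldsymbol{\epsilon}}f(\boldsymbol{x})=\lim_{h\to0^+}\frac{\Delta_f^n[\boldsymbol{x},\boldsymbol{x}+h\boldsymbol{\epsilon}]}{h^n},$$ when the limit exists (as a finite real number), where $[\boldsymbol{x},\boldsymbol{x}+h\boldsymbol{\epsilon}]$ denotes the product of the intervals $[x_i,x_i+h]$ if $\epsilon_i=1$ and $[x_i-h,x_i]$ if $\epsilon_i=-1$ (so the increment is taken with each interval's endpoints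 in increasing order). *)

(* Defs.v *)
From HB Require Import structures.
From mathcomp Require Import all_boot all_order all_algebra.
From mathcomp Require Import all_classical all_reals all_analysis.

Set Implicit Arguments.
Unset Strict Implicit.
Unset Printing Implicit Defensive.

Import Order.TTheory GRing.Theory Num.Theory.
Import numFieldNormedType.Exports.

Local Open Scope classical_set_scope.
Local Open Scope ring_scope.

Section Boxes.
Context {R : realType} {n : nat}.
Implicit Types c d x : 'rV[R]_n.+1.

Definition rvle c d : Prop := forall i, c 0 i <= d 0 i.

Definition box c d : set 'rV[R]_n.+1 := [set x | rvle c x /\ rvle x d].

(* Meaningful only when [rvle c d]; always used under that hypothesis. *)
Definition box_volume c d : R := \prod_i (d 0 i - c 0 i).

Lemma box_volume_ge0 c d : rvle c d -> 0 <= box_volume c d.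
Proof. by move=> cd; apply: prodr_ge0 => i _; rewrite subr_ge0. Qed.

End Boxes.

(* The library has Lebesgue measure on R only.  On R^(n+1) it is obtained here
   by Caratheodory's construction from the outer measure
     A |-> inf { \sum_k vol(B_k) | A `<=` \bigcup_k B_k, B_k closed boxes }. *)
Section LebesgueOuterMeasure.
Context {R : realType} {n : nat}.
Local Notation V := 'rV[R]_n.+1.

Definition box_cover (A : set V) : set (V * V)^nat :=
  [set B | (forall k, rvle (B k).1 (B k).2) /\
           A `<=` \bigcup_k box (B k).1 (B k).2].

Definition lebesgue_outer (A : set V) : \bar R :=
  ereal_inf
    [set (\sum_(k <oo) (box_volume (B k).1 (B k).2)%:E)%E | B in box_cover A].

Local Open Scope ereal_scope.

Lemma lebesgue_outer_ge0 A : 0 <= lebesgue_outer A.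
Proof.
apply: le_ereal_inf_tmp => _ [B [B0 _] <-].
by apply: nneseries_ge0 => k _ _; rewrite lee_fin box_volume_ge0.
Qed.

Lemma le_lebesgue_outer :
  {homo lebesgue_outer : A B / A `<=` B >-> A <= B}.
Proof.
move=> A B AB; apply/ereal_inf_le_tmp => _ [C [C0 BC] <-].
by exists C => //; split => //; exact: subset_trans BC.
Qed.

Lemma lebesgue_outer0 : lebesgue_outer set0 = 0.
Proof.
apply/eqP; rewrite eq_le lebesgue_outer_ge0 andbT.
apply: ereal_inf_lbound; exists (fun=> (0, 0)%R) => /=.
  by split => // k i.
rewrite eseries0// => k _ _.
by rewrite /box_volume big_ord_recl subrr mul0r.
Qed.

Lemma lebesgue_outer_sigma_subadditive : sigma_subadditive lebesgue_outer.
Proof.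
move=> A; have [[i ioo]|] := pselect (exists i, lebesgue_outer (A i) = +oo).
  rewrite (eseries_pinfty _ _ ioo) ?leey// => k _.
  by rewrite -ltNye (lt_le_trans _ (lebesgue_outer_ge0 _)).
rewrite -forallNE => Aoo.
suff add2e (e : {posnum R}) : lebesgue_outer (\bigcup_k A k) <=
    \sum_(i <oo) lebesgue_outer (A i) + e%:num%:E.
  by apply/lee_addgt0Pr => _/posnumP[].
rewrite (le_trans _ (epsilon_trick _ _ _))//; last first.
  by move=> k; exact: lebesgue_outer_ge0.
pose vol (B : V * V) : \bar R := (box_volume B.1 B.2)%:E.
pose P k (B : (V * V)^nat) := box_cover (A k) B /\
  \sum_(j <oo) vol (B j) <= lebesgue_outer (A k) + (e%:num / (2 ^ k.+1)%:R)%:E.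
have [G PG] : {G : ((V * V)^nat)^nat & forall k, P k (G k)}.
  apply: (@choice _ _ P) => k.
  have Afin : lebesgue_outer (A k) \is a fin_num.
    by rewrite ge0_fin_numE ?lebesgue_outer_ge0// ltey; exact/eqP/Aoo.
  have ek : (0 < e%:num / (2 ^ k.+1)%:R :> R)%R by [].
  have [_ [B BA <-] lt_e] := lb_ereal_inf_adherent ek Afin.
  by exists B; split => //; exact/ltW.
have vol_ge0 k j : 0 <= vol (G k j).
  by rewrite lee_fin box_volume_ge0//; exact: (PG k).1.1.
have volG_ge0 x : 0 <= (vol \o uncurry G) x by case: x => ? ?; exact: vol_ge0.
apply: (@le_trans _ _ (\sum_(i <oo) \sum_(j <oo) vol (G i j))); last first.
  apply: lee_nneseries => [k _ _|k _].
    by apply: nneseries_ge0 => j _ _; exact: vol_ge0.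
  exact: (PG k).2.
have -> : \sum_(i <oo) \sum_(j <oo) vol (G i j) =
    \esum_(i in setT) (vol \o uncurry G) i.
  rewrite nneseries_esumT; last first.
    by move=> k; apply: nneseries_ge0 => j _ _; exact: vol_ge0.
  transitivity (\esum_(i in [set: nat]) \esum_(j in [set: nat]) vol (G i j)).
    by apply: eq_esum => i _; rewrite nneseries_esumT.
  rewrite esum_esum//; congr esum.
    by apply/seteqP; split.
  by apply/funext => -[].
have /card_esym/ppcard_eqP[f] := card_nat2.
apply: ereal_inf_lbound; exists (uncurry G \o f) => /=.
  split => [k|t [i _]]; first by rewrite /=; case: (f k) => p q; exact: (PG p).1.1.
  move=> /((PG i).1.2 t)[j _ Gt]; exists (f^-1%FUN (i, j)) => //=.
  by rewrite invK ?inE.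
rewrite -/(vol _) nneseries_esumT; last by move=> k; exact: volG_ge0.
rewrite (reindex_esum setT setT f)//.
Qed.

HB.instance Definition _ := isOuterMeasure.Build R V lebesgue_outer
  lebesgue_outer0 lebesgue_outer_ge0 le_lebesgue_outer
  lebesgue_outer_sigma_subadditive.

End LebesgueOuterMeasure.

Section LebesgueMeasure.
Context (R : realType) (n : nat).
Let mu : {outer_measure set 'rV[R]_n.+1 -> \bar R} := @lebesgue_outer R n.

Definition lebesgue_rV :
  set (caratheodory_type (@lebesgue_outer R n)) -> \bar R := lebesgue_outer.

HB.instance Definition _ := Measure.copy lebesgue_rV
  (mu : set (caratheodory_type mu) -> \bar R).

End LebesgueMeasure.
Arguments lebesgue_rV R n : clear implicits.

Section JointDerivative.
Context {R : realType} {n : nat}.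
Implicit Types (f : 'rV[R]_n.+1 -> R) (c d x y eps : 'rV[R]_n.+1).

Definition joint_increment f c d : R :=
  \sum_(e : {ffun 'I_n.+1 -> bool})
    (-1) ^+ (n.+1 + \sum_i e i)%N *
    f (\row_i (c 0 i + (e i)%:R * (d 0 i - c 0 i))).

Definition jointly_increasing f c d : Prop :=
  forall x y, box c d x -> box c d y -> rvle x y -> 0 <= joint_increment f x y.

Definition sign_vector eps : Prop := forall i, eps 0 i = -1 \/ eps 0 i = 1.

Definition rvmin x y : 'rV[R]_n.+1 := \row_i Num.min (x 0 i) (y 0 i).
Definition rvmax x y : 'rV[R]_n.+1 := \row_i Num.max (x 0 i) (y 0 i).

(* [rvmin] and [rvmax] put the endpoints of each side in increasing order. *)
Definition joint_quotient f eps x (h : R) : R :=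
  joint_increment f (rvmin x (x + h *: eps)) (rvmax x (x + h *: eps))
    / h ^+ n.+1.

(* [D] is the domain of [f], here a total function; requiring [x] to be interior
   to [D] makes the values of [f] outside [D] irrelevant. *)
Definition joint_derivable (D : set 'rV[R]_n.+1) f eps x : Prop :=
  D° x /\ cvg (joint_quotient f eps x h @[h --> 0^'+]).

(* An arbitrary value where the limit does not exist: see [joint_derivable]. *)
Definition joint_derive f eps x : R :=
  lim (joint_quotient f eps x h @[h --> 0^'+]).

End JointDerivative.

(* Main.v *)
(* On jointly increasing [f] the joint increment is a nonnegative additive
   function [G] of boxes.  Since the box [[x, x + h eps]] is a cube containing
   [x], it suffices to differentiate [G] along all small cubes containing [x].
   Let [A] be the set of points lying in arbitrarily small cubes [Q] with
   [G Q <= r |Q|] and in arbitrarily small cubes with [p |Q| <= G Q], [r < p].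
   Two applications of Vitali's covering theorem, inside a box [C] and then
   inside each of the selected cubes, bound the outer measure of [A] in [C] by
   [(r / p) |C|]; summing over a cover of [A] by boxes gives
   [|A| <= (r / p) |A|], so [A] is null.  No measurability is involved. *)
Require Import Defs.
From mathcomp Require Import all_boot all_order all_algebra.
From mathcomp Require Import all_classical all_reals all_analysis.
From mathcomp Require Import ring lra.

Set Implicit Arguments.
Unset Strict Implicit.
Unset Printing Implicit Defensive.

Import Order.TTheory GRing.Theory Num.Theory.
Import numFieldNormedType.Exports.

Local Open Scope classical_set_scope.
Local Open Scope ring_scope.

(** * Additive functions of boxes and their superadditivity *)

Section BoxFunctions.
Context {R : realType} {n : nat}.
Local Notation V := 'rV[R]_n.+1.
Implicit Types (c d x y u v : V) (j : 'I_n.+1) (t : R) (G : V -> V -> R).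

Definition cut_below j t x : V :=
  \row_i if i == j then Num.min (x 0 i) t else x 0 i.

Definition cut_above j t x : V :=
  \row_i if i == j then Num.max (x 0 i) t else x 0 i.

(* The hyperplane [x_j = t] cuts [[c, d]] into [[cut_below c, cut_below d]] and
   [[cut_above c, cut_above d]], one of which is degenerate when the hyperplane
   misses [[c, d]]; degenerate boxes get the value [0]. *)
Definition box_additive G := forall j t c d,
  G c d = G (cut_below j t c) (cut_below j t d) +
          G (cut_above j t c) (cut_above j t d).

Definition box_nonneg G := forall c d, rvle c d -> 0 <= G c d.

(** Cutting at [t = c 0 j] returns the whole box twice, so [G c d = G c d + G c d]. *)
Lemma box_additive_degenerate G c d j :
  box_additive G -> c 0 j = d 0 j -> G c d = 0.
Proof.
move=> /(_ j (c 0 j) c d) + cdj.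
have cutE x : x 0 j = c 0 j ->
    cut_below j (c 0 j) x = x /\ cut_above j (c 0 j) x = x.
  by move=> xj; split; apply/rowP => i; rewrite mxE; case: eqP => // ->;
    rewrite xj (minxx, maxxx).
have [-> ->] := cutE c erefl; have [-> ->] := cutE d (esym cdj).
by move=> /eqP; rewrite -subr_eq subrr eq_sym => /eqP.
Qed.

Lemma cut_below_mono j t u v i :
  u 0 i <= v 0 i -> cut_below j t u 0 i <= cut_below j t v 0 i.
Proof.
move=> uv; rewrite !mxE; case: eqP => // _.
by rewrite le_min !ge_min uv lexx orbT.
Qed.

Lemma cut_above_mono j t u v i :
  u 0 i <= v 0 i -> cut_above j t u 0 i <= cut_above j t v 0 i.
Proof.
move=> uv; rewrite !mxE; case: eqP => // _.
by rewrite ge_max !le_max uv lexx orbT.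
Qed.

(** Non-strict, so boxes may share a face, and coordinatewise monotone maps such as the two cuts
    preserve it. *)
Definition separated c d x y := exists j, d 0 j <= x 0 j \/ y 0 j <= c 0 j.

Lemma separated_mono (g : V -> V) c d x y :
  (forall u v j, u 0 j <= v 0 j -> g u 0 j <= g v 0 j) ->
  separated c d x y -> separated (g c) (g d) (g x) (g y).
Proof. by move=> gle [j [H|H]]; exists j; [left|right]; exact: gle. Qed.

(* Induction on the number of faces of the [[lo i, hi i]] that properly cut
   [[c, d]]: cutting along such a face decreases it, and when there is none
   every nondegenerate [[lo i, hi i]] is [[c, d]] itself. *)
Lemma box_superadditive G (I : finType) (lo hi : I -> V) c d :
  box_additive G -> box_nonneg G -> rvle c d ->
  (forall i, [/\ rvle c (lo i), rvle (lo i) (hi i) & rvle (hi i) d]) ->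
  (forall i k, i != k -> separated (lo i) (hi i) (lo k) (hi k)) ->
  \sum_i G (lo i) (hi i) <= G c d.
Proof.
move=> addG G0.
pose face (lo hi : I -> V) (z : I * 'I_n.+1 * bool) :=
  (if z.2 then hi z.1.1 else lo z.1.1) 0 z.1.2.
pose cuts lo hi c d := [set z | (c 0 z.1.2 < face lo hi z < d 0 z.1.2)%R]%SET.
have [k] := ubnP #|cuts lo hi c d|.
elim: k => // k IH in lo hi c d *; rewrite ltnS => cardk cd sub sep.
have [/eqP cuts0|/set0Pn[z zcut]] := boolP (cuts lo hi c d == finset.set0).
  have faceE z : face lo hi z = c 0 z.1.2 \/ face lo hi z = d 0 z.1.2.
    have /negbT : z \in cuts lo hi c d = false by rewrite cuts0 finset.in_set0.
    rewrite inE negb_and -!leNgt => /orP[] H; [left|right]; apply/eqP;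
      rewrite eq_le H /= /face; case: z {H} => -[i j] [] /=;
      have [/(_ j) H1 /(_ j) H2 /(_ j) H3] := sub i; lra.
  have [[j cdj]|/forallNP nd] := pselect (exists j, c 0 j = d 0 j).
    rewrite big1 ?G0// => i _; apply: (@box_additive_degenerate _ _ _ j) => //.
    have [/(_ j) H1 /(_ j) H2 /(_ j) H3] := sub i; lra.
  have dich i : G (lo i) (hi i) = 0 \/ lo i = c /\ hi i = d.
    have [[j lohi]|/forallNP ndi] := pselect (exists j, lo i 0 j = hi i 0 j).
      by left; exact: (@box_additive_degenerate _ _ _ j).
    right; suff H j : lo i 0 j = c 0 j /\ hi i 0 j = d 0 j.
      by split; apply/rowP => j; have [] := H j.
    have := faceE (i, j, true); have := faceE (i, j, false); rewrite /face /=.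
    have [/(_ j) H1 /(_ j) H2 /(_ j) H3] := sub i.
    by have := ndi j; move=> ? [] ? [] ?; split => //; lra.
  (* Two distinct indices cannot both give the nondegenerate box [[c, d]], which is not separated
     from itself. *)
  have [[i [loi hii]]|/forallNP no] := pselect (exists i, lo i = c /\ hi i = d).
    rewrite (bigD1 i)//= loi hii big1 ?addr0// => l li.
    have [//|[lol hil]] := dich l.
    have [j] := sep _ _ li; rewrite lol hil loi hii => dc.
    by case: (nd j); have := cd j; case: dc => ? ?; lra.
  by rewrite big1 ?G0// => i _; have [//|/no] := dich i.
set j := z.1.2; set t := face lo hi z.
have ct : c 0 j < t by move: zcut; rewrite inE => /andP[].
have td : t < d 0 j by move: zcut; rewrite inE => /andP[].
have tE : (if z.2 then hi z.1.1 else lo z.1.1) 0 j = t by [].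
rewrite (addG j t c d) (eq_bigr _ (fun i _ => addG j t (lo i) (hi i))).
rewrite big_split /= lerD//.
- apply: IH.
  + apply: leq_trans cardk; apply: proper_card; apply/properP; split.
      apply/fintype.subsetP => -[[i l] b]; rewrite !inE /face /= !mxE.
      have [/(_ l) H1 /(_ l) H2 /(_ l) H3] := sub i.
      case: b; rewrite !mxE; case: eqP => // lj; move: H1 H2 H3; rewrite lj;
        rewrite !minEle; do ?case: ifP; move=> *; lra.
    (* Cutting at [t] puts the face [z] on the boundary of the half box, so it no longer cuts
       properly. *)
    exists z => //; rewrite inE /face.
    suff -> : (if z.2 then cut_below j t (hi z.1.1)
              else cut_below j t (lo z.1.1)) 0 z.1.2 = t.
      rewrite !mxE eqxx !minEle; do ?case: ifP; move=> *; lra.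
    by move: tE; case: (z.2) => tE; rewrite mxE eqxx tE minxx.
  + by move=> i; exact: cut_below_mono.
  + by move=> i; have [H1 H2 H3] := sub i; split=> l; exact: cut_below_mono.
  + by move=> i l il; apply: separated_mono (sep _ _ il); exact: cut_below_mono.
- apply: IH.
  + apply: leq_trans cardk; apply: proper_card; apply/properP; split.
      apply/fintype.subsetP => -[[i l] b]; rewrite !inE /face /= !mxE.
      have [/(_ l) H1 /(_ l) H2 /(_ l) H3] := sub i.
      case: b; rewrite !mxE; case: eqP => // lj; move: H1 H2 H3; rewrite lj;
        rewrite !maxEle; do ?case: ifP; move=> *; lra.
    exists z => //; rewrite inE /face.
    suff -> : (if z.2 then cut_above j t (hi z.1.1)
              else cut_above j t (lo z.1.1)) 0 z.1.2 = t.
      rewrite !mxE eqxx !maxEle; do ?case: ifP; move=> *; lra.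
    by move: tE; case: (z.2) => tE; rewrite mxE eqxx tE maxxx.
  + by move=> i; exact: cut_above_mono.
  + by move=> i; have [H1 H2 H3] := sub i; split=> l; exact: cut_above_mono.
  + by move=> i l il; apply: separated_mono (sep _ _ il); exact: cut_above_mono.
Qed.

Lemma box_volume_additive : box_additive (@box_volume R n).
Proof.
move=> j t c d; rewrite /box_volume !(bigD1 (P:=xpredT) j)//= !mxE !eqxx.
have eqp (g : V -> V) : (forall x i, i != j -> g x 0 i = x 0 i) ->
    \prod_(i < n.+1 | i != j) (g d 0 i - g c 0 i) =
    \prod_(i < n.+1 | i != j) (d 0 i - c 0 i).
  by move=> gE; apply: eq_bigr => i ij; rewrite !gE.
rewrite (eqp (cut_below j t)) ?(eqp (cut_above j t)); last 2 first.
- by move=> x i /negbTE ij; rewrite mxE ij.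
- by move=> x i /negbTE ij; rewrite mxE ij.
rewrite -mulrDl; congr (_ * _).
by rewrite !minEle !maxEle; case: ifP => _; case: ifP => _; lra.
Qed.

(** At each corner the two pieces evaluate [f] with [j]-th coordinate [min s t] and [max s t], that
    is, [s] and [t] in some order. The terms at [s] form the original increment; those at [t] cancel
    in pairs. *)
Lemma joint_increment_additive (f : V -> R) : box_additive (joint_increment f).
Proof.
move=> j t c d.
pose sg (e : {ffun 'I_n.+1 -> bool}) : R := (-1) ^+ (n.+1 + \sum_i e i)%N.
pose corner c d (e : {ffun 'I_n.+1 -> bool}) : V :=
  \row_i (if i == j then t else if e i then d 0 i else c 0 i).
have incrE c' d' : joint_increment f c' d' =
    \sum_e sg e * f (\row_i (if e i then d' 0 i else c' 0 i)).
  apply: eq_bigr => e _; congr (_ * f _); apply/rowP => i; rewrite !mxE.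
  by case: (e i) => /=; ring.
rewrite !incrE.
have flip0 : \sum_e sg e * f (corner c d e) = 0.
  (* Flipping [e j] keeps the corner, whose [j]-th coordinate is [t], and reverses the sign. *)
  pose flip (e : {ffun 'I_n.+1 -> bool}) : {ffun 'I_n.+1 -> bool} :=
    [ffun i => if i == j then ~~ e i else e i].
  have flipK : involutive flip.
    by move=> e; apply/ffunP => i; rewrite !ffunE; case: eqP; rewrite ?negbK.
  have : \sum_e sg e * f (corner c d e) = - \sum_e sg e * f (corner c d e).
    rewrite {1}(reindex_inj (can_inj flipK)) -sumrN; apply: eq_bigr => e _.
    have -> : corner c d (flip e) = corner c d e.
      by apply/rowP => i; rewrite !mxE !ffunE; case: eqP.
    rewrite -mulNr; congr (_ * _); rewrite /sg !exprD -mulrN; congr (_ * _).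
    rewrite [in LHS](bigD1 j)//= [in RHS](bigD1 j)//= !exprD ffunE eqxx.
    rewrite (eq_bigr (fun i => e i : nat)); last first.
      by move=> i /negbTE ij; rewrite ffunE ij.
    rewrite -mulNr; congr (_ * _).
    by case: (e j); rewrite /= expr0 expr1 ?opprK.
  by move=> /eqP; rewrite -addr_eq0 -mulr2n mulrn_eq0 => /eqP.
rewrite -[LHS]addr0 -[X in _ + X = _]flip0 -!big_split /=.
apply: eq_bigr => e _; rewrite -!mulrDr; congr (_ * _).
pose s := if e j then d 0 j else c 0 j.
pose p r : V := \row_i (if i == j then r else if e i then d 0 i else c 0 i).
have -> : \row_i (if e i then cut_below j t d 0 i else cut_below j t c 0 i) =
    p (Num.min s t).
  by apply/rowP => i; rewrite !mxE /s; case: eqP => // ->; case: (e j).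
have -> : \row_i (if e i then cut_above j t d 0 i else cut_above j t c 0 i) =
    p (Num.max s t).
  by apply/rowP => i; rewrite !mxE /s; case: eqP => // ->; case: (e j).
have -> : \row_i (if e i then d 0 i else c 0 i) = p s.
  by apply/rowP => i; rewrite !mxE /s; case: eqP => // ->; case: (e j).
rewrite -/(p t) minEle maxEle; case: ifP => _ //; exact: addrC.
Qed.

End BoxFunctions.

(** * Vitali's covering theorem for cubes *)

Section Vitali.
Context {R : realType} {n : nat}.
Local Notation V := 'rV[R]_n.+1.
Implicit Types (c d x : V) (A : set V) (p q : V * R).

Definition cube q : set V := box q.1 (q.1 + const_mx q.2).

Lemma cubeP q x :
  cube q x <-> forall j, q.1 0 j <= x 0 j /\ x 0 j <= q.1 0 j + q.2.
Proof.
split=> [[lo hi] j|H]; first by have := lo j; have := hi j; rewrite !mxE.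
by split=> j; have [] := H j; rewrite ?mxE.
Qed.

Lemma box_volume_cube x (s : R) :
  box_volume x (x + const_mx s) = s ^+ n.+1.
Proof.
rewrite /box_volume (eq_bigr (fun=> s)) ?prodr_const ?card_ord// => i _.
by rewrite !mxE; ring.
Qed.

Lemma lebesgue_outer_le A (B : (V * V)^nat) (M : R) :
  box_cover A B -> (forall m, \sum_(k < m) box_volume (B k).1 (B k).2 <= M) ->
  (lebesgue_outer A <= M%:E)%E.
Proof.
move=> AB BM; apply: (@le_trans _ _
    (\sum_(k <oo) (box_volume (B k).1 (B k).2)%:E)%E).
  by apply: ereal_inf_lbound; exists B.
apply: lime_le.
  apply: is_cvg_nneseries => k _ _; rewrite lee_fin.
  by apply: box_volume_ge0; exact: AB.1.
by apply: nearW => m; rewrite big_mkord sumEFin lee_fin.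
Qed.

Lemma lebesgue_outer_box c d :
  rvle c d -> (lebesgue_outer (box c d) <= (box_volume c d)%:E)%E.
Proof.
move=> cd; pose B k : V * V := if k == 0%N then (c, d) else (0, 0).
apply: (@lebesgue_outer_le _ B).
  split=> [k|x cdx]; first by rewrite /B; case: eqP => //= _ i.
  by exists 0%N.
case=> [|m]; first by rewrite big_ord0 box_volume_ge0.
rewrite big_ord_recl/= big1 ?addr0// => k _.
by rewrite /box_volume big_ord_recl subrr mul0r.
Qed.

Lemma lebesgue_outer_split A m (Q : 'I_m -> set V) :
  (lebesgue_outer A <= lebesgue_outer (A `\` \bigcup_i Q i) +
     \sum_(i < m) lebesgue_outer (A `&` Q i))%E.
Proof.
(* The finite family becomes a sequence, continued by [set0]. *)
pose F k := if insub k is Some i then A `&` Q i else set0.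
have FE (i : 'I_m) : F i = A `&` Q i by rewrite /F valK.
pose mu : {outer_measure set V -> \bar R} := @lebesgue_outer R n.
have := outer_measureU2 mu (A `\` \bigcup_i Q i) (\big[setU/set0]_(i < m) F i).
move=> /(le_trans _) H; apply: (le_trans (H _ _)).
  apply: le_lebesgue_outer => x Ax.
  have [[i _ Qx]|] := pselect ((\bigcup_i Q i) x); last by left.
  by right; rewrite -bigcup_mkord; exists i => //=; rewrite FE.
apply: leeD => //; apply: (le_trans (outer_measure_subadditive mu F m)).
by apply: lee_sum => i _; rewrite FE.
Qed.

(** Strict, unlike [separated]: for nonnegative sides this is disjointness of the closed cubes. *)
Definition apart p q :=
  exists j, p.1 0 j + p.2 < q.1 0 j \/ q.1 0 j + q.2 < p.1 0 j.

Lemma apart_sym p q : apart p q -> apart q p.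
Proof. by move=> [j [H|H]]; exists j; [right|left]. Qed.

Lemma apart_separated p q : apart p q ->
  separated p.1 (p.1 + const_mx p.2) q.1 (q.1 + const_mx q.2).
Proof.
by move=> [j [H|H]]; exists j; rewrite !mxE; [left|right]; exact: ltW.
Qed.

(** A finite union of closed cubes is closed, so a point outside has a positive distance to it. *)
Lemma small_cube_apart (l : seq (V * R)) x :
  (forall p, p \in l -> ~ cube p x) ->
  exists2 e : R, 0 < e &
    forall q, cube q x -> q.2 < e -> forall p, p \in l -> apart p q.
Proof.
elim: l => [|p l IH] xl; first by exists 1.
have [|e e0 eP] := IH; first by move=> p' pl; apply: xl; rewrite inE pl orbT.
have [j pj] : exists j, x 0 j < p.1 0 j \/ p.1 0 j + p.2 < x 0 j.
  apply: contrapT => /forallNP npx; apply: (xl p); first by rewrite mem_head.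
  apply/cubeP => j; have /not_orP[/negP H1 /negP H2] := npx j.
  by move: H1 H2; rewrite -!leNgt.
pose g := Num.max (p.1 0 j - x 0 j) (x 0 j - (p.1 0 j + p.2)).
have g0 : 0 < g by rewrite lt_max !subr_gt0; case: pj => ->; rewrite ?orbT.
exists (Num.min e g); first by rewrite lt_min e0.
move=> q qx; rewrite lt_min => /andP[qe qg] p'.
rewrite inE => /predU1P[->|]; last exact: eP.
exists j; have /cubeP/(_ j)[lo hi] := qx.
by move: qg; rewrite /g lt_max => /orP[?|?]; [right|left]; lra.
Qed.

(** In each direction [q] meets [p], hence protrudes at either end by at most its side, itself at
    most [2 * p.2]; and [5 = 2 + 1 + 2]. *)
Lemma not_apart_enlarge p q x : 0 < p.2 -> q.2 <= 2 * p.2 -> ~ apart p q ->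
  cube q x -> cube (p.1 - const_mx (2 * p.2), 5 * p.2) x.
Proof.
move=> p0 qp pq /cubeP qx; apply/cubeP => j /=; rewrite !mxE.
have [lo hi] := qx j.
have /forallNP/(_ j)/not_orP[/negP H1 /negP H2] := pq.
by move: H1 H2; rewrite -!leNgt => H1 H2; split; lra.
Qed.

Lemma cubes_volume_le c d m (q : 'I_m -> V * R) : rvle c d ->
  (forall i, [/\ 0 < (q i).2, rvle c (q i).1 &
                 rvle ((q i).1 + const_mx (q i).2) d]) ->
  (forall i k, i != k -> apart (q i) (q k)) ->
  \sum_i (q i).2 ^+ n.+1 <= box_volume c d.
Proof.
move=> cd qcd aq.
under eq_bigr => i _ do rewrite -(box_volume_cube (q i).1).
apply: box_superadditive => //.
- exact: box_volume_additive.
- by move=> ? ?; exact: box_volume_ge0.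
- move=> i; have [q0 H1 H2] := qcd i; split => // j.
  by rewrite !mxE lerDl ltW.
- by move=> i k ik; apply: apart_separated; exact: aq.
Qed.

Lemma series_tail_le (u : R^nat) (M e : R) : (forall i, 0 <= u i) ->
  (forall m, \sum_(i < m) u i <= M) -> 0 < e ->
  exists k, forall m, \sum_(i < m) u (k + i)%N <= e.
Proof.
move=> u0 uM e0; pose S := range (fun m => \sum_(i < m) u i).
have supS : has_sup S.
  by split; [exists 0, 0%N; rewrite ?big_ord0|exists M => _ [m _ <-]].
have [_ [k _ <-] Sk] := sup_adherent e0 supS.
exists k => m; have : \sum_(i < k + m) u i <= sup S.
  by apply: sup_upper_bound => //; exists (k + m)%N.
by rewrite big_split_ord/=; lra.
Qed.

(* Greedy choice: each new cube has at least half the maximal side among those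
   apart from the previously chosen ones, hence all the cubes left out are
   covered by the fivefold enlargements of the chosen ones. *)
Lemma vitali_cubes c d A (S : set (V * R)) (e : R) : rvle c d ->
  (forall q, S q ->
    [/\ 0 < q.2, rvle c q.1 & rvle (q.1 + const_mx q.2) d]) ->
  (forall x, A x -> forall r : R, 0 < r ->
    exists q, [/\ S q, q.2 < r & cube q x]) ->
  0 < e ->
  exists m (q : 'I_m -> V * R),
    [/\ forall i, S (q i), forall i k, i != k -> apart (q i) (q k) &
        (lebesgue_outer (A `\` \bigcup_i cube (q i)) <= e%:E)%E].
Proof.
move=> cd Scd SA e0.
(* The cubes still eligible once those in [l] have been chosen. *)
pose G (l : seq (V * R)) := [set q | S q /\ forall p, p \in l -> apart p q].
have far x l : A x -> (forall p, p \in l -> ~ cube p x) ->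
    exists2 q, G l q & cube q x.
  move=> Ax /small_cube_apart[r r0 rP].
  have [q [Sq qr qx]] := SA _ Ax _ r0.
  by exists q => //; split => // p; exact: rP.
have [pick pickP] : {pick : seq (V * R) -> V * R & forall l, G l !=set0 ->
    G l (pick l) /\ forall q, G l q -> q.2 <= 2 * (pick l).2}.
  apply: (@choice _ _ (fun l p => G l !=set0 ->
    G l p /\ forall q, G l q -> q.2 <= 2 * p.2)) => l.
  (* With no eligible cube left, [(0, 0)] is a placeholder. *)
  have [[q0 Gq0]|] := pselect (G l !=set0); last by exists (0, 0).
  pose E := [set q.2 | q in G l].
  have supE : has_sup E.
    split; first by exists q0.2, q0.
    exists (d 0 0 - c 0 0) => _ [q [/Scd[q0' /(_ 0) lo /(_ 0) hi] _] <-].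
    by move: hi; rewrite !mxE; lra.
  have leE q : G l q -> q.2 <= sup E.
    by move=> Gq; apply: sup_upper_bound => //; exists q.
  have supE0 : 0 < sup E / 2.
    by rewrite divr_gt0// (lt_le_trans _ (leE _ Gq0))//; have [/Scd[]] := Gq0.
  have [_ [p Gp <-] pE] := sup_adherent supE0 supE.
  by exists p => _; split => // q /leE; lra.
pose l k := iter k (fun l => pick l :: l) [::].
pose q k := pick (l k).
have mem_l p k : p \in l k -> exists2 i, (i < k)%N & p = q i.
  elim: k => // k IH; rewrite /l /= -/(l k) inE => /predU1P[->|/IH[i ik ->]].
    by exists k.
  by exists i => //; exact: ltnW.
have l_mem i k : (i < k)%N -> q i \in l k.
  elim: k => // k IH; rewrite ltnS leq_eqVlt /l /= -/(l k) inE.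
  by move=> /predU1P[->|/IH ->]; rewrite ?eqxx ?orbT.
have aq m : (forall i, (i < m)%N -> G (l i) !=set0) ->
    forall i k : 'I_m, i != k -> apart (q i) (q k).
  move=> Gm i k; rewrite neq_ltn => /orP[ik|ki].
    by have [[_ ]] := pickP _ (Gm _ (ltn_ord k)) => /(_ _ (l_mem _ _ ik)).
  have [[_ ]] := pickP _ (Gm _ (ltn_ord i)) => /(_ _ (l_mem _ _ ki)) + _.
  exact: apart_sym.
have Sq m : (forall i, (i < m)%N -> G (l i) !=set0) ->
    forall i : 'I_m, S (q i).
  by move=> Gm i; have [[]] := pickP _ (Gm _ (ltn_ord i)).
(* If the choice stops after [k] cubes, these cover [A]: a point of [A] outside them would have an
   eligible cube. *)
have [Gall|/existsNP Gempty] := pselect (forall i, G (l i) !=set0); last first.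
  have exb : exists i, `[< ~ (G (l i) !=set0) >].
    by have [i Gi] := Gempty; exists i; apply/asboolP.
  case: (ex_minnP exb) => k /asboolP Gk mink.
  have Gm i : (i < k)%N -> G (l i) !=set0.
    move=> ik; apply: contrapT => /asboolP/mink.
    by rewrite leqNgt ik.
  exists k, (fun i => q i); split; [exact: Sq|exact: aq|].
  rewrite (_ : _ `\` _ = set0) ?lebesgue_outer0 ?lee_fin ?ltW//.
  apply/seteqP; split => // x [Ax nx]; case: Gk.
  have [|p Gp _] := far x (l k) Ax; last by exists p.
  by move=> p /mem_l[i ik ->] qix; apply: nx; exists (Ordinal ik).
have Gm m i : (i < m)%N -> G (l i) !=set0 by [].
have q0 i : 0 < (q i).2 by have [] := Scd _ (Sq i.+1 (Gm _) ord_max).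
pose u i := (q i).2 ^+ n.+1.
have u0 i : 0 <= u i by rewrite exprn_ge0// ltW.
have uM m : \sum_(i < m) u i <= box_volume c d.
  apply: (@cubes_volume_le _ _ _ (fun i : 'I_m => q i)) => //.
    by move=> i; apply: Scd; exact: Sq (Gm m) i.
  exact: aq.
have small (r : R) : 0 < r -> exists m, (q m).2 < r.
  move=> r0; apply: contrapT => /forallNP rq.
  have rN0 : 0 < r ^+ n.+1 by rewrite exprn_gt0.
  (* More cubes of side at least [r] than the volume of [[c, d]] can hold. *)
  pose m := (Num.truncn (box_volume c d / r ^+ n.+1)).+1.
  have : m%:R * r ^+ n.+1 <= box_volume c d.
    apply: le_trans (uM m).
    rewrite mulr_natl -[X in _ *+ X]card_ord -sumr_const.
    apply: ler_sum => i _; apply: lerXn2r; [exact: ltW|exact: ltW|].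
    by have /negP := rq i; rewrite -leNgt.
  by rewrite -ler_pdivlMr// leNgt truncnS_gt.
(* The fivefold enlargement multiplies volumes by [5 ^+ n.+1]. *)
have e50 : 0 < e / 5 ^+ n.+1 by rewrite divr_gt0// exprn_gt0.
have [k kP] := series_tail_le u0 uM e50.
exists k, (fun i => q i); split; [exact: Sq|exact: aq|].
pose Q j : V * R := ((q (k + j)%N).1 - const_mx (2 * (q (k + j)%N).2),
  5 * (q (k + j)%N).2).
apply: (@lebesgue_outer_le _ (fun j => ((Q j).1, (Q j).1 + const_mx (Q j).2))).
  split=> [j i|x [Ax nx]].
    by rewrite !mxE lerDl mulr_ge0// ltW.
  have [|p Gp px] := far x (l k) Ax.
    by move=> p /mem_l[i ik ->] qix; apply: nx; exists (Ordinal ik).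
  have Sp : S p by case: Gp.
  have p0 : 0 < p.2 by have [] := Scd _ Sp.
  have exb : exists i, `[< ~ apart (q i) p >].
    (* A choice of side less than [p.2 / 2] shows that [p] was not eligible at that stage, hence is
       not apart from some earlier choice. *)
    have [m qm] := small (p.2 / 2) (divr_gt0 p0 (ltr0n _ 2)).
    have : ~ G (l m) p by move=> /((pickP _ (Gall m)).2); rewrite -/(q m); lra.
    move=> nG; apply: contrapT => /forallNP ap; apply: nG; split=> // p'.
    by move=> /mem_l[i _ ->]; apply: contrapT => /asboolP/ap.
  (* Minimality of [i] makes [p] eligible at stage [i], whence [p.2 <= 2 * (q i).2]; and [k <= i]
     because [p] is apart from the first [k] choices. *)
  case: (ex_minnP exb) => i /asboolP qip mini.
  have ki : (k <= i)%N.
    rewrite leqNgt; apply/negP => ik; apply: qip; case: Gp => _; apply.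
    exact: l_mem.
  exists (i - k)%N => //=; rewrite subnKC//.
  apply: (@not_apart_enlarge _ p) => //; apply: (pickP _ (Gall i)).2.
  split=> // p' /mem_l[i' ii' ->]; apply: contrapT => /asboolP/mini.
  by rewrite leqNgt ii'.
move=> m; under eq_bigr do rewrite box_volume_cube exprMn.
rewrite -mulr_sumr mulrC -ler_pdivlMr ?exprn_gt0//.
Qed.

End Vitali.

(** * Fine covers by small cubes *)

Section Derivates.
Context {R : realType} {n : nat}.
Local Notation V := 'rV[R]_n.+1.
Implicit Types (c d x : V) (A : set V) (q : V * R) (P : set (V * R)).

Definition inside c d : set V := [set x | forall i, c 0 i < x 0 i < d 0 i].

(** For [x] inside, the distance to the faces, capped at [1]: a cube through [x] of smaller side
    stays in the box. *)
Definition margin c d x : R :=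
  \big[Num.min/1]_i Num.min (x 0 i - c 0 i) (d 0 i - x 0 i).

Lemma margin_gt0 c d x : inside c d x -> 0 < margin c d x.
Proof.
move=> cdx; apply: lt_bigmin => // i _.
by rewrite lt_min !subr_gt0; have /andP[-> ->] := cdx i.
Qed.

Lemma marginP c d x (r : R) : r <= margin c d x ->
  forall i, c 0 i + r <= x 0 i /\ x 0 i + r <= d 0 i.
Proof.
move=> rm i; have := le_trans rm (bigmin_le _ i _).
by rewrite le_min => /andP[]; split; lra.
Qed.

Lemma inside_interior c d x : inside c d x -> (box c d)° x.
Proof.
move=> cdx; apply/nbhs_ballP; exists (margin c d x); first exact: margin_gt0.
move=> y [_ xy]; have H := marginP (lexx (margin c d x)).
by split=> i; have [] := H i; have := xy 0 i; rewrite /ball/= ltr_norml;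
  move=> /andP[]; lra.
Qed.

(** The boundary lies in finitely many degenerate boxes, each of volume [0]. *)
Lemma box_boundary_null c d : rvle c d ->
  lebesgue_outer (box c d `\` inside c d) = 0%E.
Proof.
move=> cd; apply/eqP; rewrite eq_le lebesgue_outer_ge0 andbT.
(* [cut_above] raises one coordinate of [c] to that of [d]; [cut_below] lowers one coordinate of [d]
   to that of [c]. *)
pose face (z : 'I_n.+1 * bool) : set V :=
  if z.2 then box (cut_above z.1 (d 0 z.1) c) d
  else box c (cut_below z.1 (c 0 z.1) d).
have face0 z : (lebesgue_outer (face z) <= 0)%E.
  case: z => j [] /=; rewrite /face /=.
    have cj : cut_above j (d 0 j) c 0 j = d 0 j.
      by rewrite mxE eqxx; apply/max_idPr.
    apply: (le_trans (lebesgue_outer_box _)).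
      by move=> i; rewrite mxE; case: eqP => // ->; rewrite ge_max cd lexx.
    by rewrite lee_fin (box_additive_degenerate (@box_volume_additive _ _) cj).
  have cj : c 0 j = cut_below j (c 0 j) d 0 j.
    by rewrite mxE eqxx; apply/esym/min_idPr.
  apply: (le_trans (lebesgue_outer_box _)).
    by move=> i; rewrite mxE; case: eqP => // ->; rewrite le_min cd lexx.
  by rewrite lee_fin (box_additive_degenerate (@box_volume_additive _ _) cj).
apply: (le_trans (@lebesgue_outer_split _ _ _ _
  (fun k : 'I_#|{: 'I_n.+1 * bool}| => face (enum_val k)))).
rewrite [X in (lebesgue_outer X + _)%E](_ : _ = set0); last first.
  apply/seteqP; split => // x [[[cx xd] ncdx] nfx]; apply: ncdx => i.
  rewrite !lt_neqAle cx xd !andbT.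
  apply/andP; split; apply/eqP => xi; apply: nfx.
    exists (enum_rank (i, false)) => //; rewrite enum_rankK; split => // j.
    by rewrite mxE; case: eqP => // ->; rewrite xi le_min xd lexx.
  exists (enum_rank (i, true)) => //; rewrite enum_rankK; split => // j.
  by rewrite mxE; case: eqP => // ->; rewrite -xi ge_max cx lexx.
rewrite lebesgue_outer0 add0e; apply: sume_le0 => k _.
by apply: le_trans (face0 (enum_val k)); apply: le_lebesgue_outer => x [].
Qed.

(** The cubes satisfying [P] form a Vitali cover at [x], which may sit anywhere in them, in
    particular at any vertex. *)
Definition fine_at P x := forall r : R, 0 < r ->
  exists q, [/\ 0 < q.2, q.2 < r, cube q x & P q].

(** Vitali's theorem is applied with cubes within [[c, d]]: at interior points small cubes fit, and
    the boundary is null. *)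
Lemma cube_covering c d A P (e : R) : rvle c d -> A `<=` box c d ->
  A `<=` fine_at P -> 0 < e ->
  exists m (q : 'I_m -> V * R),
    [/\ forall i, P (q i),
        forall i, [/\ 0 < (q i).2, rvle c (q i).1 &
                      rvle ((q i).1 + const_mx (q i).2) d],
        forall i k, i != k -> apart (q i) (q k) &
        (lebesgue_outer A <=
           e%:E + \sum_i lebesgue_outer (A `&` cube (q i)))%E].
Proof.
move=> cd Acd AP e0.
pose S : set (V * R) := [set q | P q /\ [/\ 0 < q.2, rvle c q.1 &
  rvle (q.1 + const_mx q.2) d]].
have AS x : (A `&` inside c d) x -> forall r : R, 0 < r ->
    exists q, [/\ S q, q.2 < r & cube q x].
  move=> [/AP Px cdx] r r0.
  have rm0 : 0 < Num.min r (margin c d x) by rewrite lt_min r0 margin_gt0.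
  have [q [q0 + qx Pq]] := Px _ rm0; rewrite lt_min => /andP[qr qm].
  have H := marginP (ltW qm); have /cubeP xq := qx.
  by exists q; split => //; split => //; split => // i; rewrite ?mxE;
    have := H i; have := xq i; lra.
have [|m [q [Sq aq Aq]]] := vitali_cubes cd _ AS e0; first by move=> q [].
exists m, q; split => // [i|i|]; [by have [] := Sq i|by have [] := Sq i|].
apply: (le_trans (lebesgue_outer_split _ (fun i => cube (q i)))).
apply: leeD => //; rewrite -[leRHS]adde0 -(box_boundary_null cd).
pose mu : {outer_measure set V -> \bar R} := @lebesgue_outer R n.
apply: (le_trans _ (leeD Aq (lexx _))).
apply: (le_trans _ (outer_measureU2 mu _ _)).
apply: le_lebesgue_outer => x [Ax nx].
have [cdx|ncdx] := pselect (inside c d x); first by left.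
by right; split => //; exact: Acd.
Qed.

(** * Outer measure bounds from the derivates of a box function *)

Section BoxFunction.
Variable G : V -> V -> R.
Hypotheses (addG : box_additive G) (G0 : box_nonneg G).

Definition cube_value q := G q.1 (q.1 + const_mx q.2).

Lemma sum_cube_value_le c d m (q : 'I_m -> V * R) : rvle c d ->
  (forall i, [/\ 0 < (q i).2, rvle c (q i).1 &
                 rvle ((q i).1 + const_mx (q i).2) d]) ->
  (forall i k, i != k -> apart (q i) (q k)) ->
  \sum_i cube_value (q i) <= G c d.
Proof.
move=> cd qcd aq; apply: box_superadditive => //.
- move=> i; have [q0 H1 H2] := qcd i; split => // j.
  by rewrite !mxE lerDl ltW.
- by move=> i k ik; apply: apart_separated; exact: aq.
Qed.

(** The selected cubes have volume at most [cube_value q / p], and by superadditivity these bounds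
    sum to at most [G c d / p]. *)
Lemma lebesgue_outer_fine_ge c d A (p : R) : 0 < p -> rvle c d ->
  A `<=` box c d ->
  A `<=` fine_at [set q | p * q.2 ^+ n.+1 <= cube_value q] ->
  (lebesgue_outer A <= (G c d / p)%:E)%E.
Proof.
move=> p0 cd Acd AP; apply/lee_addgt0Pr => e e0.
have [m [q [qP qcd aq Aq]]] := cube_covering cd Acd AP e0.
rewrite addeC; apply: (le_trans Aq); apply: leeD => //.
apply: (@le_trans _ _ (\sum_i (cube_value (q i) / p)%:E)%E).
  apply: lee_sum => i _; have [q0 _ _] := qcd i.
  apply: (@le_trans _ _ (lebesgue_outer (cube (q i)))).
    by apply: le_lebesgue_outer => x [].
  apply: (le_trans (lebesgue_outer_box _)).
    by move=> j; rewrite !mxE lerDl ltW.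
  by rewrite box_volume_cube lee_fin ler_pdivlMr// mulrC; exact: qP.
rewrite sumEFin lee_fin -mulr_suml ler_pM2r ?invr_gt0//.
exact: sum_cube_value_le.
Qed.

(** Cubes with small values are selected first; in each, the previous bound gives
    [cube_value q / p], at most [r / p] times the volume of [q]. *)
Lemma lebesgue_outer_fine_le_ge c d A (r p : R) : 0 <= r -> 0 < p ->
  rvle c d ->
  A `<=` fine_at [set q | p * q.2 ^+ n.+1 <= cube_value q] ->
  A `<=` fine_at [set q | cube_value q <= r * q.2 ^+ n.+1] ->
  (lebesgue_outer (A `&` box c d) <= (r / p * box_volume c d)%:E)%E.
Proof.
move=> r0 p0 cd Ap Ar; apply/lee_addgt0Pr => e e0.
have {}Ar : A `&` box c d `<=`
    fine_at [set q | cube_value q <= r * q.2 ^+ n.+1].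
  by move=> x [/Ar].
have Acd : A `&` box c d `<=` box c d by move=> x [].
have [m [q [qP qcd aq Aq]]] := cube_covering cd Acd Ar e0.
rewrite addeC; apply: (le_trans Aq); apply: leeD => //.
apply: (@le_trans _ _ (\sum_i (r / p * (q i).2 ^+ n.+1)%:E)%E).
  apply: lee_sum => i _; have [q0 _ _] := qcd i.
  have qle : rvle (q i).1 ((q i).1 + const_mx (q i).2).
    by move=> j; rewrite !mxE lerDl ltW.
  apply: (le_trans (lebesgue_outer_fine_ge p0 qle _ _)).
  - by move=> x [].
  - by move=> x [[Ax _] _]; exact: Ap.
  - by rewrite lee_fin mulrAC ler_pM2r ?invr_gt0//; exact: qP.
rewrite sumEFin lee_fin -mulr_sumr.
apply: ler_wpM2l; first by rewrite divr_ge0// ltW.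
exact: cubes_volume_le.
Qed.

(* The bound of [lebesgue_outer_fine_le_ge] on every box of a cover makes the
   outer measure at most [r / p < 1] times itself. *)
Lemma fine_le_ge_null c d A (r p : R) : 0 <= r -> r < p -> rvle c d ->
  A `<=` box c d ->
  A `<=` fine_at [set q | p * q.2 ^+ n.+1 <= cube_value q] ->
  A `<=` fine_at [set q | cube_value q <= r * q.2 ^+ n.+1] ->
  lebesgue_outer A = 0%E.
Proof.
move=> r0 rp cd Acd Ap Ar; have p0 : 0 < p := le_lt_trans r0 rp.
have Afin : lebesgue_outer A \is a fin_num.
  rewrite ge0_fin_numE ?lebesgue_outer_ge0//.
  apply: (@le_lt_trans _ _ (box_volume c d)%:E); last by rewrite ltry.
  by apply: le_trans (lebesgue_outer_box cd); exact: le_lebesgue_outer.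
(* Sum over a cover by boxes whose total volume exceeds the outer measure by less than [e]. *)
have le_rp (e : R) : 0 < e ->
    fine (lebesgue_outer A) <= r / p * (fine (lebesgue_outer A) + e).
  move=> e0; have [_ [B [B0 AB] <-] lt_e] := lb_ereal_inf_adherent e0 Afin.
  rewrite -lee_fin EFinM EFinD fineK//.
  apply: (@le_trans _ _ ((r / p)%:E *
      \sum_(k <oo) (box_volume (B k).1 (B k).2)%:E)%E); last first.
    by rewrite lee_wpmul2l ?lee_fin ?divr_ge0// ltW.
  rewrite -nneseriesZl; last by move=> k _; rewrite lee_fin box_volume_ge0.
  pose mu : {outer_measure set V -> \bar R} := @lebesgue_outer R n.
  apply: (@le_trans _ _
      (\sum_(k <oo) lebesgue_outer (A `&` box (B k).1 (B k).2))%E).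
    apply: le_trans (outer_measure_bigcup_lim mu _ A).
    by apply: le_lebesgue_outer => x Ax; split => //; exact: AB.
  apply: lee_nneseries => [k _ _|k _]; first exact: lebesgue_outer_ge0.
  by rewrite -EFinM; exact: lebesgue_outer_fine_le_ge.
rewrite -(fineK Afin); congr (_%:E); apply/eqP; rewrite eq_le.
rewrite fine_ge0 ?lebesgue_outer_ge0// andbT.
set m := fine _ in le_rp *.
(* Let [e] tend to [0]; as [r / p < 1], the inequality forces [m <= 0]. *)
have : m <= r / p * m.
  apply/ler_addgt0Pr => e e0; have rp1 : r / p <= 1.
    by rewrite ler_pdivrMr// mul1r ltW.
  by have := le_rp e e0; have := divr_ge0 r0 (ltW p0); nra.
rewrite -subr_le0 -{1}[m]mul1r -mulrBl pmulr_rle0// subr_gt0.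
by rewrite ltr_pdivrMr// mul1r.
Qed.

Lemma fine_unbounded_null c d A : rvle c d -> A `<=` box c d ->
  (forall p : R, 0 < p ->
    A `<=` fine_at [set q | p * q.2 ^+ n.+1 <= cube_value q]) ->
  lebesgue_outer A = 0%E.
Proof.
move=> cd Acd Ap; apply/eqP; rewrite eq_le lebesgue_outer_ge0 andbT.
apply/lee_addgt0Pr => e e0; rewrite add0e.
(* With this [p] the bound [G c d / p] is at most [e]; the [+ 1] keeps [p] positive when
   [G c d = 0]. *)
have p0 : 0 < (G c d + 1) / e by rewrite divr_gt0// ltr_pwDr ?G0.
apply: (le_trans (lebesgue_outer_fine_ge p0 cd Acd (Ap _ p0))).
have Gcd := G0 cd.
rewrite lee_fin ler_pdivrMr// mulrC divfK ?gt_eqF//; lra.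
Qed.

End BoxFunction.

End Derivates.

(** * Right limits at [0] by excluding oscillation *)

Section Frequently.
Context {R : realType}.
Implicit Types (P Q : set R) (u : bool -> R -> R).

(** Dual to [\near 0^'+]: it fails exactly when [~ P h] holds near [0^'+]. *)
Definition frequently P := forall r : R, 0 < r ->
  exists h, [/\ 0 < h, h < r & P h].

Lemma not_frequently P : ~ frequently P ->
  exists2 r : R, 0 < r & forall h, 0 < h -> h < r -> ~ P h.
Proof.
move=> /existsNP[r /not_implyP[r0 /forallNP nP]]; exists r => // h h0 hr Ph.
by apply: (nP h).
Qed.

Lemma frequently_meet P Q (r : R) : frequently P -> 0 < r ->
  (forall h, 0 < h -> h < r -> P h -> Q h) -> frequently Q.
Proof.
move=> fP r0 PQ s s0; have rs0 : 0 < Num.min r s by rewrite lt_min r0.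
have [h [h0 + Ph]] := fP _ rs0; rewrite lt_min => /andP[hr hs].
by exists h; split => //; exact: PQ.
Qed.

Lemma frequently_near P Q : ~ frequently P -> (forall h, ~ P h -> Q h) ->
  frequently Q.
Proof.
move=> /not_frequently[r r0 nP] PQ s s0; pose h := Num.min r s / 2.
have m0 : 0 < Num.min r s by rewrite lt_min r0.
have [h0 hr hs] : [/\ 0 < h, h < r & h < s].
  have mr : Num.min r s <= r by rewrite ge_min lexx.
  have ms : Num.min r s <= s by rewrite ge_min lexx orbT.
  by rewrite /h; split; lra.
by exists h; split => //; apply: PQ; exact: nP.
Qed.

Lemma near_not_frequently P : ~ frequently P -> \forall h \near 0^'+, ~ P h.
Proof.
move=> /not_frequently[r r0 nP]; near=> h; apply: nP.
  by near: h; exact: nbhs_right_gt.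
by near: h; exact: nbhs_right_lt.
Unshelve. all: by end_near. Qed.

(* The common limit is the upper limit of [u true]. *)
Lemma cvg_of_no_oscillation u (d : R) : 0 < d ->
  (forall s h, 0 < h -> h < d -> 0 <= u s h) ->
  (forall s, ~ forall p : R, 0 < p -> frequently [set h | p < u s h]) ->
  (forall s s' (r p : rat), 0 <= (ratr r : R) -> (ratr r : R) < ratr p ->
    frequently [set h | u s h < ratr r] ->
    frequently [set h | ratr p < u s' h] -> False) ->
  exists L : R, forall s, u s h @[h --> 0^'+] --> L.
Proof.
move=> d0 u0 ubd nosc.
pose E := [set y | frequently [set h | y < u true h]].
(* Nonnegativity of [u true] near [0] puts every negative level in [E], so [E] is nonempty and
   [0 <= L]. *)
have Eneg y : y < 0 -> E y.
  move=> y0 r r0; have m0 : 0 < Num.min r d by rewrite lt_min r0.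
  have mr : Num.min r d <= r by rewrite ge_min lexx.
  have md : Num.min r d <= d by rewrite ge_min lexx orbT.
  exists (Num.min r d / 2); split; rewrite /=; [lra|lra|].
  by apply: (lt_le_trans y0); apply: u0; lra.
have supE : has_sup E.
  split; first by exists (-1); apply: Eneg; rewrite oppr_lt0.
  have /existsNP[p /not_implyP[p0 np]] := ubd true.
  exists p => y Ey; rewrite leNgt; apply/negP => py; apply: np.
  by apply: (frequently_meet Ey ltr01) => h _ _ /=; exact: lt_trans.
pose L := sup E.
have leL y : E y -> y <= L by exact: sup_upper_bound.
have L0 : 0 <= L.
  apply/ler_addgt0Pr => e e0; rewrite -lerBlDr sub0r.
  by apply: leL; apply: Eneg; rewrite oppr_lt0.
(* If [u s] frequently exceeds [L + e], rationals [r < p] in between separate it from [u true],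
   which stays below [r] near [0] because [L + e / 4] is not in [E]. *)
have upper s e : 0 < e -> ~ frequently [set h | L + e < u s h].
  move=> e0 fs.
  have [r] : exists r : rat, ratr r \in `]L + e / 4, (L + e / 2)[.
    by apply: rat_in_itvoo; lra.
  rewrite in_itv/= => /andP[Lr rL].
  have [p] : exists p : rat, ratr p \in `](L + e / 2), (L + e)[.
    by apply: rat_in_itvoo; lra.
  rewrite in_itv/= => /andP[Lp pL].
  apply: (nosc true s r p); [lra|lra| |].
    have nE : ~ E (L + e / 4) by move=> /leL; lra.
    by apply: (frequently_near nE) => h /negP; rewrite -leNgt /=; lra.
  by apply: (frequently_meet fs ltr01) => h _ _ /=; lra.
have lower s e : 0 < e -> ~ frequently [set h | u s h < L - e].
  move=> e0 fs.
  (* This [h] gives [0 <= u s h < L - e], so that the rational [r] chosen above [L - e] is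
     nonnegative. *)
  have [h [h0 hd ush]] := fs _ d0; have us0 := u0 s h h0 hd.
  rewrite /= in ush.
  have [r] : exists r : rat, ratr r \in `](L - e), (L - e / 2)[.
    by apply: rat_in_itvoo; lra.
  rewrite in_itv/= => /andP[Lr rL].
  have [p] : exists p : rat, ratr p \in `](L - e / 2), (L - e / 4)[.
    by apply: rat_in_itvoo; lra.
  rewrite in_itv/= => /andP[Lp pL].
  apply: (nosc s true r p); [lra|lra| |].
    by apply: (frequently_meet fs ltr01) => k _ _ /=; lra.
  have e40 : 0 < e / 4 by lra.
  have [y Ey Ly] := sup_adherent e40 supE.
  by apply: (frequently_meet Ey ltr01) => k _ _ /=; rewrite -/L in Ly; lra.
exists L => s; apply/cvgrPdist_le => e e0.
near=> h; rewrite ler_norml.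
have /negP : ~ (L + e < u s h).
  by near: h; apply: near_not_frequently; exact: upper.
have /negP : ~ (u s h < L - e).
  by near: h; apply: near_not_frequently; exact: lower.
by rewrite -!leNgt; lra.
Unshelve. all: by end_near. Qed.

End Frequently.

(** * Null sets and almost everywhere statements *)

Section NullSets.
Context {R : realType} {n : nat}.
Local Notation V := 'rV[R]_n.+1.

Lemma lebesgue_outer_bigcup0 (T : countType) (F : T -> set V) :
  (forall t, lebesgue_outer (F t) = 0%E) ->
  lebesgue_outer (\bigcup_t F t) = 0%E.
Proof.
move=> F0; apply/eqP; rewrite eq_le lebesgue_outer_ge0 andbT.
pose F' k := if unpickle k is Some t then F t else set0.
apply: (@le_trans _ _ (lebesgue_outer (\bigcup_k F' k))).
  apply: le_lebesgue_outer => x [t _ Ftx]; exists (pickle t) => //.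
  by rewrite /F' pickleK.
apply: (le_trans (lebesgue_outer_sigma_subadditive F')).
rewrite eseries0// => k _ _; rewrite /F'.
by case: unpickle => [t|]; rewrite ?F0 ?lebesgue_outer0.
Qed.

Lemma lebesgue_outer_setU0 (A B : set V) :
  lebesgue_outer A = 0%E -> lebesgue_outer B = 0%E ->
  lebesgue_outer (A `|` B) = 0%E.
Proof.
move=> A0 B0; apply/eqP; rewrite eq_le lebesgue_outer_ge0 andbT.
pose mu : {outer_measure set V -> \bar R} := @lebesgue_outer R n.
by apply: (le_trans (outer_measureU2 mu A B)); rewrite /mu/= A0 B0 adde0.
Qed.

(** An outer null set is Caratheodory measurable: a test set meets it in a null set, and the rest is
    bounded by monotonicity. *)
Lemma lebesgue_outer_ae (N : set V) (P : V -> Prop) :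
  lebesgue_outer N = 0%E -> (forall x, ~ N x -> P x) ->
  {ae lebesgue_rV R n, forall x, P x}.
Proof.
move=> N0 NP; pose mu : {outer_measure set V -> \bar R} := @lebesgue_outer R n.
exists N; split.
- apply: (@le_caratheodory_measurable _ _ mu N) => X.
  rewrite -[leRHS]add0e; apply: leeD.
    by rewrite -N0; apply: le_lebesgue_outer => x [].
  by apply: le_lebesgue_outer => x [].
- exact: N0.
- by move=> x /= nPx; apply: contrapT => /NP.
Qed.

End NullSets.

(** * Joint derivatives of a jointly increasing function *)

Section JointDerivatives.
Context {R : realType} {n : nat}.
Local Notation V := 'rV[R]_n.+1.
Variables (a b : V) (f : V -> R).
Hypotheses (ab : rvle a b) (f_incr : jointly_increasing f a b).
Implicit Types (c d x eps : V).

Definition clamp x : V := \row_i Num.max (a 0 i) (Num.min (x 0 i) (b 0 i)).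

Lemma box_clamp x : box a b (clamp x).
Proof.
split=> i; rewrite mxE; first by rewrite le_max lexx.
by rewrite ge_max ge_min lexx orbT ab.
Qed.

Lemma clamp_id x : box a b x -> clamp x = x.
Proof.
move=> [ax xb]; apply/rowP => i; rewrite mxE.
by rewrite (min_idPl (xb i)); apply/max_idPr.
Qed.

Lemma le_clamp (lo hi s t : R) : s <= t ->
  Num.max lo (Num.min s hi) <= Num.max lo (Num.min t hi).
Proof.
move=> st; rewrite ge_max !le_max lexx /=; apply/orP; right.
by rewrite le_min !ge_min st lexx orbT.
Qed.

Lemma clamp_mono c d : rvle c d -> rvle (clamp c) (clamp d).
Proof. by move=> cd i; rewrite !mxE; exact: le_clamp. Qed.

(** [f] is controlled only on [[a, b]]; composing with the projection [clamp] gives a box function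
    that is additive and nonnegative everywhere and agrees with the joint increment within
    [[a, b]]. *)
Definition clamped_increment c d := joint_increment f (clamp c) (clamp d).

(** [clamp] commutes with the cuts once the level [t] is clamped too. *)
Lemma clamped_increment_additive : box_additive clamped_increment.
Proof.
move=> j t c d; rewrite /clamped_increment.
pose t' := Num.max (a 0 j) (Num.min t (b 0 j)).
have below x : clamp (cut_below j t x) = cut_below j t' (clamp x).
  apply/rowP => i; rewrite !mxE; case: eqP => // ->; rewrite /t'.
  by have [xt|/ltW tx] := leP (x 0 j) t; apply/esym;
    [apply: min_l|apply: min_r]; exact: le_clamp.
have above x : clamp (cut_above j t x) = cut_above j t' (clamp x).
  apply/rowP => i; rewrite !mxE; case: eqP => // ->; rewrite /t'.
  by have [xt|/ltW tx] := leP (x 0 j) t; apply/esym;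
    [apply: max_r|apply: max_l]; exact: le_clamp.
by rewrite !below !above -joint_increment_additive.
Qed.

Lemma clamped_increment_ge0 : box_nonneg clamped_increment.
Proof.
move=> c d cd; apply: f_incr; [exact: box_clamp|exact: box_clamp|].
exact: clamp_mono.
Qed.

(** For a sign vector and [h > 0] this encodes the box [[x, x + h eps]]. *)
Definition quadrant_cube eps x (h : R) : V * R := (rvmin x (x + h *: eps), h).

Lemma rvmax_quadrant eps x h : sign_vector eps -> 0 < h ->
  rvmax x (x + h *: eps) = rvmin x (x + h *: eps) + const_mx h.
Proof.
move=> sg h0; apply/rowP => i; rewrite !mxE maxEle minEle.
by have [->|->] := sg i; case: ifP; lra.
Qed.

Lemma quadrant_cube_mem eps x h : sign_vector eps -> 0 < h ->
  cube (quadrant_cube eps x h) x.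
Proof.
move=> sg h0; apply/cubeP => i /=; rewrite !mxE minEle.
by have [->|->] := sg i; case: ifP; split; lra.
Qed.

Lemma joint_quotientE eps x h : sign_vector eps -> inside a b x ->
  0 < h -> h < margin a b x ->
  joint_quotient f eps x h =
  cube_value clamped_increment (quadrant_cube eps x h) / h ^+ n.+1.
Proof.
move=> sg abx h0 hm; rewrite /joint_quotient rvmax_quadrant//.
rewrite /cube_value /clamped_increment/=.
have H := marginP (ltW hm); have /cubeP/= Q := quadrant_cube_mem x sg h0.
rewrite !clamp_id//.
all: by split=> i; have := H i; have := Q i; move: (rvmin _ _) => z;
  rewrite ?mxE; lra.
Qed.

Lemma frequently_fine_ge eps x (p : R) : sign_vector eps -> inside a b x ->
  frequently [set h | p < joint_quotient f eps x h] ->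
  fine_at [set q | p * q.2 ^+ n.+1 <= cube_value clamped_increment q] x.
Proof.
move=> sg abx fp r r0.
have m0 : 0 < Num.min r (margin a b x) by rewrite lt_min r0 margin_gt0.
have [h [h0 + /=]] := fp _ m0; rewrite lt_min => /andP[hr hm].
rewrite joint_quotientE// => ph; exists (quadrant_cube eps x h).
split => //; first exact: quadrant_cube_mem.
by rewrite /= -ler_pdivlMr ?exprn_gt0// ltW.
Qed.

Lemma frequently_fine_le eps x (r : R) : sign_vector eps -> inside a b x ->
  frequently [set h | joint_quotient f eps x h < r] ->
  fine_at [set q | cube_value clamped_increment q <= r * q.2 ^+ n.+1] x.
Proof.
move=> sg abx fr s s0.
have m0 : 0 < Num.min s (margin a b x) by rewrite lt_min s0 margin_gt0.
have [h [h0 + /=]] := fr _ m0; rewrite lt_min => /andP[hr hm].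
rewrite joint_quotientE// => hr'; exists (quadrant_cube eps x h).
split => //; first exact: quadrant_cube_mem.
by rewrite /= -ler_pdivrMr ?exprn_gt0// ltW.
Qed.

Lemma inside_box : inside a b `<=` box a b.
Proof. by move=> x abx; split=> i; have /andP[] := abx i => /ltW + /ltW. Qed.

(** Two sign vectors are treated together, so that a single [L] serves both and equality of the
    derivatives comes with their existence. The exceptional set collects the boundary, the points of
    unbounded quotients and the oscillation sets. *)
Lemma joint_quotient_cvg (eps : bool -> V) : (forall s, sign_vector (eps s)) ->
  exists2 N : set V, lebesgue_outer N = 0%E &
    forall x, box a b x -> ~ N x -> (box a b)° x /\
      exists L : R, forall s, joint_quotient f (eps s) x h @[h --> 0^'+] --> L.
Proof.
move=> sg; have addG := clamped_increment_additive.
have G0 := clamped_increment_ge0.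
pose U s := [set x | inside a b x /\ forall p : R, 0 < p ->
  frequently [set h | p < joint_quotient f (eps s) x h]].
(* Rational levels keep this family countable; allowing [s] and [s'] to differ excludes distinct
   limits. *)
pose B (z : rat * rat * bool * bool) := let: (r, p, s, s') := z in
  [set x | [/\ 0 <= (ratr r : R), (ratr r : R) < ratr p, inside a b x,
    frequently [set h | joint_quotient f (eps s) x h < ratr r] &
    frequently [set h | ratr p < joint_quotient f (eps s') x h]]].
exists ((box a b `\` inside a b) `|` (\bigcup_s U s) `|` (\bigcup_z B z)).
  apply: lebesgue_outer_setU0; first apply: lebesgue_outer_setU0.
  - exact: box_boundary_null.
  - apply: lebesgue_outer_bigcup0 => s.
    apply: (fine_unbounded_null addG G0 ab).
      by move=> x [/inside_box].
    by move=> p p0 x [abx /(_ _ p0)]; exact: frequently_fine_ge.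
  - apply: lebesgue_outer_bigcup0 => -[[[r p] s] s'].
    have [r0|r0] := leP 0 (ratr r : R); last first.
      rewrite (_ : B _ = set0) ?lebesgue_outer0//.
      by apply/seteqP; split => // x [+ _ _ _ _]; rewrite leNgt r0.
    have [rp|pr] := ltP (ratr r : R) (ratr p); last first.
      rewrite (_ : B _ = set0) ?lebesgue_outer0//.
      by apply/seteqP; split => // x [_ + _ _ _]; rewrite ltNge pr.
    apply: (fine_le_ge_null addG G0 r0 rp ab).
    + by move=> x [_ _ /inside_box].
    + by move=> x [_ _ abx _]; exact: frequently_fine_ge.
    + by move=> x [_ _ abx + _]; exact: frequently_fine_le.
move=> x abx nN.
have insx : inside a b x.
  by apply: contrapT => ninsx; apply: nN; left; left.
split; first exact: inside_interior.
apply: (cvg_of_no_oscillation (margin_gt0 insx)).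
- move=> s h h0 hm; rewrite joint_quotientE//.
  apply: divr_ge0; last by rewrite exprn_ge0// ltW.
  by apply: G0 => i; rewrite !mxE lerDl ltW.
- by move=> s fs; apply: nN; left; right; exists s.
- by move=> s s' r p r0 rp fr fp; apply: nN; right; exists (r, p, s, s').
Qed.

End JointDerivatives.

Theorem proposition1p2 (R : realType) (n : nat) (a b : 'rV[R]_n.+1)
    (ab : forall i, a 0 i < b 0 i) (f : 'rV[R]_n.+1 -> R)
    (f_incr : jointly_increasing f a b) :
  (forall eps : 'rV[R]_n.+1, sign_vector eps ->
    {ae lebesgue_rV R n, forall x, box a b x ->
      joint_derivable (box a b) f eps x}) /\
  (forall eps eps' : 'rV[R]_n.+1, sign_vector eps -> sign_vector eps' ->
    eps <> eps' ->
    {ae lebesgue_rV R n, forall x, box a b x ->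
      [/\ joint_derivable (box a b) f eps x,
          joint_derivable (box a b) f eps' x &
          joint_derive f eps x = joint_derive f eps' x]}).
Proof.
have ab' : rvle a b by move=> i; exact: ltW.
have main eps eps' : sign_vector eps -> sign_vector eps' ->
    {ae lebesgue_rV R n, forall x, box a b x ->
      [/\ joint_derivable (box a b) f eps x,
          joint_derivable (box a b) f eps' x &
          joint_derive f eps x = joint_derive f eps' x]}.
  move=> sg sg'.
  have [|N N0 NP] := @joint_quotient_cvg _ _ _ _ _ ab' f_incr
    (fun s => if s then eps else eps'); first by case.
  apply: (lebesgue_outer_ae N0) => x nNx abx.
  have [abx' [L uL]] := NP x abx nNx.
  have := uL false; have := uL true => /= epsL epsL'.
  split; [by split => //; apply/cvg_ex; exists L..|].
  by rewrite /joint_derive (cvg_lim _ epsL)// (cvg_lim _ epsL').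
split=> [eps sg|eps eps' sg sg' _]; last exact: main.
(* The first claim is the case of two equal vectors. *)
have [N [mN N0 NP]] := main eps eps sg sg.
exists N; split => // x /= nPx; apply: NP => /= H; apply: nPx => abx.
by have [] := H abx.
Qed.
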